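(* For any constant $c>2$ there is a choice of sample size $\ell=O(\log n)$ such that the following holds for any weighted stream of $n$ updates: with probability at least $1-1/n$ (over the algorithm's random sampling), for every integer $0\le j<k/c$ and every item $i\in[m]$, the estimate $\hat f_i$ returned by the Reduce-By-Sample-Median algorithm (defined in the context) with $k$ counters and sample size $\ell$ satisfies $$0\le f_i-\hat f_i\le \frac{N^{\mathrm{res}(j)}}{k/c-j}.$$
   Context: A weighted stream over the universe $[m]=\{1,\dots,m\}$ is a sequence of updates $(i_1,\Delta_1),\dots,(i_n,\Delta_n)$ with $i_t\in[m]$ and real weights $\Delta_t>0$. The frequency of $i$ is $f_i=\sum_{t: i_t=i}\Delta_t$. $N^{\mathrm{res}(j)}$ denotes the sum of the frequencies of all items except the $j$ items of largest frequency (ties broken arbitrarily). The Reduce-By-Sample-Median algorithm with parameters $k\ge 1$ (number of counters) and $\ell\ge 1$ (sample size) maintains a set $T\subseteq[m]$ of at most $k$ items, each $j\in T$ carrying a nonnegative real counter $c(j)$; initially $T=\emptyset$. Update$(i,\Delta)$: if $i\in T$, set $c(i)\gets c(i)+\Delta$; else if $|T|<k$, add $i$ to $T$ with $c(i)=\Delta$; else call DecrementCounters(), and afterwards, if $\Delta\ge c^*$, add $i$ to $T$ with $c(i)=\Delta-c^*$. DecrementCounters(): sample $\ell$ counters uniformly at random from $T$ (fresh randomness in each call) and let $c^*$ be the median of the sampled counter values; for every $j\in T$ set $c(j)\gets c(j)-c^*$, and remove $j$ from $T$ if now $c(j)\le 0$. Estimate$(i)$ returns $c(i)$ if $i\in T$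 and $0$ otherwise. *)

(* Defs.v *)
From HB Require Import structures.
From mathcomp Require Import all_boot all_order all_algebra.
From mathcomp Require Import reals.
Set Implicit Arguments. Unset Strict Implicit. Unset Printing Implicit Defensive.
Import Order.TTheory GRing.Theory Num.Theory.
Local Open Scope ring_scope.

Section RBSM.
Variable R : realType.

(* Items are 'I_m (the universe [m] = {1..m} shifted to {0..m-1}).
   A stream is a sequence of updates (item, weight). *)

Definition freq (m : nat) (s : seq ('I_m * R)) (i : 'I_m) : R :=
  \sum_(p <- s | p.1 == i) p.2.

Definition Nres (m : nat) (s : seq ('I_m * R)) (j : nat) : R :=
  \sum_(x <- drop j (sort (fun x y : R => y <= x) [seq freq s i | i <- enum 'I_m])) x.

(* Algorithm state: the set T of tracked items and the counters c. *)
Definition state (m : nat) := ({set 'I_m} * ('I_m -> R))%type.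

(* Random choice of one DecrementCounters call: l indices, each uniform in 'I_k,
   into the enumeration of T (|T| = k whenever DecrementCounters is called);
   i.e. l counters sampled uniformly at random (with replacement) from T. *)
Definition rnd (k l : nat) := {ffun 'I_l -> 'I_k}.

(* The median c* of the sampled counter values (lower median for even l). *)
Definition sample_median (m k l : nat) (st : state m) (r : rnd k l) : R :=
  let vals := [seq st.2 x | x <- enum st.1] in
  let smp := [seq nth 0 vals (r t) | t <- enum 'I_l] in
  nth 0 (sort (fun x y : R => x <= y) smp) (l.-1)./2.

Definition decrement (m : nat) (st : state m) (cs : R) : state m :=
  ([set x in st.1 | 0 < st.2 x - cs], fun x => st.2 x - cs).

Definition setc (m : nat) (c : 'I_m -> R) (i : 'I_m) (v : R) : 'I_m -> R :=
  fun x => if x == i then v else c x.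

Definition update (m k l : nat) (st : state m) (u : 'I_m * R) (r : rnd k l)
  : state m :=
  let: (i, d) := u in
  if i \in st.1 then (st.1, setc st.2 i (st.2 i + d))
  else if (#|st.1| < k)%N then (i |: st.1, setc st.2 i d)
  else
    let cs := sample_median st r in
    let st' := decrement st cs in
    if cs <= d then (i |: st'.1, setc st'.2 i (d - cs)) else st'.

Definition init_state (m : nat) : state m := (set0, fun _ => 0).

Definition run (m k l : nat) (s : seq ('I_m * R)) (rs : seq (rnd k l)) : state m :=
  foldl (fun st ur => update st ur.1 ur.2) (init_state m) (zip s rs).

Definition estimate (m : nat) (st : state m) (i : 'I_m) : R :=
  if i \in st.1 then st.2 i else 0.

Definition prob (T : finType) (P : pred T) : R := #|P|%:R / #|T|%:R.

End RBSM.

(* Main.v *)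
Require Import Defs.
From HB Require Import structures.
From mathcomp Require Import all_boot all_order all_algebra.
From mathcomp Require Import reals.
From mathcomp Require Import zify lra ring.
Set Implicit Arguments. Unset Strict Implicit. Unset Printing Implicit Defensive.
Import Order.TTheory GRing.Theory Num.Theory.
Local Open Scope ring_scope.

(** Write c* for the median subtracted by a DecrementCounters call and E for the
    sum of all the c*.  Every error f_i - est_i is at most E.  If in each call at
    least k/c counters are >= c*, then each call adds at least (k/c) c* to the
    total error, hence (k/c) E <= sum_i (f_i - est_i) <= j E + N^res(j), which
    bounds E.  A call fails this condition only if half of its sample falls in a
    set of fewer than k/c counters; as 1/c < 1/2, a Chernoff bound makes this
    exponentially unlikely in the sample size, and a union bound over the n
    updates concludes. *)

(** * Order statistics and sample medians *)

Lemma count_ge_nth_sorted d (T : orderType d) (x0 : T) (s : seq T) (i : nat) :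
  sorted <=%O s ->
  (size s - i <= count (fun y => nth x0 s i <= y)%O s)%N.
Proof.
move=> srt; rewrite -(count_predC (fun y => nth x0 s i <= y)%O s) leq_subLR.
rewrite addnC leq_add2r.
rewrite (eq_count (a2 := (fun y => y < nth x0 s i)%O)); last first.
  by move=> y /=; rewrite -ltNge.
(* More than [i] entries below the [i]-th one would put it below itself. *)
by rewrite leqNgt; apply/negP => /(nth_count_lt x0 srt); rewrite ltxx.
Qed.

Lemma card_set_count (T : finType) (A : {set T}) (P : pred T) :
  #|[set x in A | P x]| = count P (enum A).
Proof.
rewrite -sum1_count big_enum_cond -sum1_card.
by apply: eq_bigl => x; rewrite inE.
Qed.

Lemma card_ord_nth_count (T : Type) (x0 : T) (s : seq T) (k : nat) (P : pred T) :
  size s = k -> #|[set a : 'I_k | P (nth x0 s a)]| = count P s.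
Proof.
move=> sz; rewrite -sum1_count (big_nth x0) big_mkord sz -sum1_card.
by apply: eq_bigl => x; rewrite inE.
Qed.

(** At most [(l.-1)./2] samples lie strictly below the lower median, which leaves at least half of
    them. *)
Lemma half_sample_ge_median (R : realType) (k l : nat) (v : 'I_k -> R)
    (r : rnd k l) (smp := [seq v (r t) | t <- enum 'I_l])
    (med := nth 0 (sort (fun x y : R => x <= y) smp) (l.-1)./2) :
  (l <= (#|[set t | (med <= v (r t))%R]|).*2)%N.
Proof.
have srt : sorted <=%O (sort (fun x y : R => x <= y) smp).
  by apply: sort_sorted; exact: le_total.
have := count_ge_nth_sorted 0 (l.-1)./2 srt.
rewrite size_sort size_map size_enum_ord -/med count_sort count_map.
have -> : #|[set t | med <= v (r t)]| =
    count (preim (fun t => v (r t)) (fun y => med <= y)) (enum 'I_l).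
  by rewrite -sum1_count big_enum_cond -sum1_card; apply: eq_bigl => x; rewrite inE.
move: (count _ _) => h.
by lia.
Qed.

(** Positivity of [l] keeps the median index in range, so the default [0] is never returned. *)
Lemma sample_median_mem (R : realType) (T : Type) (l : nat) (v : T -> R)
    (r : 'I_l -> T) (smp := [seq v (r t) | t <- enum 'I_l]) :
  (0 < l)%N ->
  exists a, nth 0 (sort (fun x y : R => x <= y) smp) (l.-1)./2 = v a.
Proof.
move=> l0.
have : nth 0 (sort (fun x y : R => x <= y) smp) (l.-1)./2 \in smp.
  rewrite -(mem_sort (fun x y : R => x <= y)) mem_nth //.
  by rewrite size_sort size_map size_enum_ord; lia.
by case/mapP => t _ ->; exists (r t).
Qed.

(** * Chernoff bound for one sample *)

(** Mean of a variable equal to [c / 2] with probability [1 / c] and to [2 / c] otherwise. *)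
Definition tail_rate (R : realType) (c : R) : R := 2 / c + 2^-1 - 2 / c ^+ 2.

Lemma tail_rateE (R : realType) (c : R) (c2 : 2 < c) :
  1 - tail_rate c = (c - 2) ^+ 2 / (2 * c ^+ 2).
Proof.
have c0 : c != 0 by rewrite gt_eqF //; lra.
by rewrite /tail_rate; field.
Qed.

Lemma tail_rate_lt1 (R : realType) (c : R) (c2 : 2 < c) : tail_rate c < 1.
Proof.
by rewrite -subr_gt0 (tail_rateE c2) divr_gt0 ?mulr_gt0 ?exprn_gt0 //; lra.
Qed.

Lemma tail_rate_ge0 (R : realType) (c : R) (c2 : 2 < c) : 0 <= tail_rate c.
Proof.
have ci : c^-1 < 2^-1 by rewrite ltf_pV2 ?posrE //; lra.
have ci0 : 0 < c^-1 by rewrite invr_gt0; lra.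
rewrite /tail_rate -exprVn; nra.
Qed.

(* Markov's inequality for the moment generating function at w = c / 2: the
   product of w over the hits and w^-1 over the misses has mean at most tail_rate^l. *)
Lemma card_majority_le (R : realType) (c : R) (c2 : 2 < c) (k l : nat) (B : {set 'I_k}) :
  #|B|%:R < k%:R / c ->
  #|[set r : rnd k l | (l <= (#|[set t | r t \in B]|).*2)%N]|%:R
    <= tail_rate c ^+ l * #|{: rnd k l}|%:R.
Proof.
move=> hB.
pose w : R := c / 2.
have w1 : 1 <= w by rewrite /w; lra.
have w0 : 0 < w by lra.
pose F (a : 'I_k) : R := if a \in B then w else w^-1.
have F0 a : 0 <= F a by rewrite /F; case: ifP => _; rewrite ?invr_ge0 ltW.
rewrite -sum1_card natr_sum.
(* With [h >= l / 2] hits the product is [w ^+ (2 * h - l) >= 1], so it dominates the indicator of a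
   majority. *)
apply: (@le_trans _ _ (\sum_(r : rnd k l) \prod_t F (r t))).
  rewrite [X in _ <= X](bigID
    (mem [set r : rnd k l | (l <= (#|[set t | r t \in B]|).*2)%N])) /=.
  apply: ler_wpDr; first by apply: sumr_ge0 => r _; apply: prodr_ge0.
  apply: ler_sum => r; rewrite inE => hr.
  rewrite (bigID (fun t => r t \in B)) /=.
  set h := #|_| in hr.
  have -> : \prod_(i | r i \in B) F (r i) = w ^+ h.
    rewrite /h -prodr_const; apply: eq_big => [t|t rt]; first by rewrite inE.
    by rewrite /F rt.
  have -> : \prod_(i | r i \notin B) F (r i) = w^-1 ^+ (l - h).
    have -> : (l - h)%N = #|~: [set t | r t \in B]|.
      by rewrite cardsCs setCK card_ord.
    rewrite -prodr_const; apply: eq_big => [t|t rt]; first by rewrite !inE.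
    by rewrite /F (negbTE rt).
  rewrite exprVn -exprB ?unitfE ?gt_eqF //; last by lia.
  by rewrite exprn_ege1.
(* Independence of the draws: the sum of the products is the [l]-th power of a single sum. *)
rewrite -(bigA_distr_bigA (fun (_ : 'I_l) a => F a)) prodr_const card_ord.
rewrite card_ffun !card_ord natrX -exprMn.
have Fs : \sum_a F a = #|B|%:R * w + (k%:R - #|B|%:R) * w^-1.
  rewrite (bigID (mem B)) /=; congr (_ + _).
    rewrite mulr_natl -sumr_const; by apply: eq_bigr => a ha; rewrite /F ha.
  have -> : k%:R - #|B|%:R = #|~: B|%:R :> R.
    by have := cardsC B; rewrite card_ord => {1}<-; rewrite natrD addrC addKr.
  rewrite mulr_natl -sumr_const; apply: eq_big => [a|a ha]; first by rewrite !inE.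
  by rewrite /F (negbTE ha).
apply: lerXn2r; rewrite ?nnegrE ?sumr_ge0 ?mulr_ge0 ?(tail_rate_ge0 c2) //.
have c0 : c != 0 by rewrite gt_eqF //; lra.
have -> : tail_rate c * k%:R = k%:R / w + k%:R / c * (w - w^-1).
  by rewrite /tail_rate /w; field.
rewrite Fs.
(* As [w^-1 <= w], the sum grows with [#|B|], which may be replaced by [k / c]. *)
have wi : w^-1 <= w by rewrite (le_trans _ w1) // invf_le1.
rewrite mulrBl addrCA -mulrBr lerD2l ler_wpM2r ?subr_ge0 //.
exact: ltW.
Qed.

(** The Bernoulli-type bound [r ^+ n * (1 + n * (1 - r)) <= 1] gives [r ^+ n <= 1 / 4] once
    [n * (1 - r) >= 3]. *)
Lemma tail_rate_exp_small (R : realType) (c : R) (c2 : 2 < c) :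
  exists K : nat, (0 < K)%N /\ tail_rate c ^+ K <= 4^-1.
Proof.
have r1 := tail_rate_lt1 c2; have r0 := tail_rate_ge0 c2.
set r := tail_rate c in r0 r1 *.
have bern n : r ^+ n * (1 + n%:R * (1 - r)) <= 1.
  elim: n => [|n IH]; first by rewrite expr0 mul1r mul0r addr0.
  apply: le_trans IH; rewrite exprS mulrAC -mulrA [X in _ <= X]mulrC [X in X <= _]mulrA.
  rewrite ler_wpM2r ?exprn_ge0 // -natr1 -subr_ge0.
  rewrite (_ : _ - _ = (n%:R + 1) * (1 - r) ^+ 2); last by ring.
  by rewrite mulr_ge0 ?sqr_ge0 ?addr_ge0.
exists (Num.bound (3 / (1 - r))).+1; split => //.
set n := (Num.bound _).+1.
have hn : 3 / (1 - r) <= n%:R.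
  apply: ltW; apply: (lt_trans (archi_boundP _)); last by rewrite ltr_nat.
  by rewrite divr_ge0 //; lra.
have h3 : 3 <= n%:R * (1 - r) by rewrite -ler_pdivrMr //; lra.
have := bern n; have := exprn_ge0 n r0.
nra.
Qed.

(** Judged whenever [T] is full, even if the update then makes no DecrementCounters call, so that it
    depends on the state and the sample alone. *)
Definition bad_median (R : realType) (c : R) (m k l : nat)
    (st : state R m) (r : rnd k l) : bool :=
  (#|st.1| == k) &&
  (#|[set x in st.1 | sample_median st r <= st.2 x]|%:R < k%:R / c).

(* The counters with fewer than k / c counters above them form an upward closed
   set B with |B| < k / c; a bad median puts half of the sample in B. *)
Lemma card_bad_median_le (R : realType) (c : R) (c2 : 2 < c) (m k l : nat) (st : state R m) :
  (0 < k)%N -> (0 < l)%N ->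
  #|[set r : rnd k l | bad_median c st r]|%:R <= tail_rate c ^+ l * #|{: rnd k l}|%:R.
Proof.
move=> k0 l0.
rewrite /bad_median; have [Tk|_] := eqVneq #|st.1| k; last first.
  rewrite (_ : [set _ | _] = set0) ?cards0; last by apply/setP => r; rewrite !inE.
  by rewrite mulr_ge0 ?exprn_ge0 ?(tail_rate_ge0 c2).
pose vals := [seq st.2 x | x <- enum st.1].
have sv : size vals = k by rewrite size_map -cardE.
pose v (a : 'I_k) := nth 0 vals a.
pose up (x : R) := [set a : 'I_k | x <= v a].
have upE x : #|[set y in st.1 | x <= st.2 y]| = #|up x|.
  by rewrite card_set_count (card_ord_nth_count 0 (fun y => x <= y)) // count_map.
pose B := [set a : 'I_k | #|up (v a)|%:R < k%:R / c].
have hB : #|B|%:R < k%:R / c.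
  have [->|[a0 a0B]] := set_0Vmem B.
    by rewrite cards0 divr_gt0 ?ltr0n //; lra.
  (* For [a] of least value in [B], [B] lies inside [up (v a)], which is small because [a] is in
     [B]. *)
  case: (arg_minP v a0B) => a aB amin.
  have : a \in B := aB.
  rewrite inE; apply: le_lt_trans.
  by rewrite ler_nat subset_leq_card //; apply/subsetP => b bB; rewrite inE amin.
apply: le_trans (card_majority_le c2 l hB); rewrite ler_nat.
apply: subset_leq_card; apply/subsetP => r; rewrite !inE /= upE => bad.
apply: leq_trans (half_sample_ge_median v r) _.
(* A value at or above the bad median has its [up] set inside that of the median, hence its index is
   in [B]. *)
rewrite leq_double; apply/subset_leq_card/subsetP => t; rewrite !inE => ht.
apply: le_lt_trans bad; rewrite ler_nat; apply/subset_leq_card/subsetP => b.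
by rewrite !inE; exact: le_trans.
Qed.

(* Double counting: (w, a) |-> (w with w t := a, w t) is an involution. *)
Lemma card_resample_le (R : realType) (I A : finType) (t : I) (q : R)
    (P : pred {ffun I -> A})
    (upd := fun (w : {ffun I -> A}) a => [ffun u => if u == t then a else w u]) :
  (0 < #|A|)%N ->
  (forall w, #|[set a | P (upd w a)]|%:R <= q * #|A|%:R) ->
  #|P|%:R <= q * #|{: {ffun I -> A}}|%:R.
Proof.
move=> A0 h.
pose phi (x : {ffun I -> A} * A) := (upd x.1 x.2, x.1 t).
have phiK : involutive phi.
  case=> w a; rewrite /phi /=; congr (_, _); last by rewrite ffunE eqxx.
  by apply/ffunP => u; rewrite !ffunE; case: eqP => // ->.
have E : \sum_(x : {ffun I -> A} * A | P x.1) (1 : R) =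
         \sum_(x : {ffun I -> A} * A | P (upd x.1 x.2)) 1.
  by rewrite (reindex_inj (inv_inj phiK)).
have L : \sum_(x : {ffun I -> A} * A | P x.1) (1 : R) = #|P|%:R * #|A|%:R.
  transitivity (\sum_(w | P w) \sum_(a : A) (1 : R)).
    by rewrite pair_big_dep; apply: eq_bigl => x; rewrite andbT.
  under eq_bigr do rewrite sumr_const.
  by rewrite sumr_const -[LHS]mulr_natr mulrC.
have A0' : 0 < #|A|%:R :> R by rewrite ltr0n.
rewrite -(ler_pM2r A0') -L E.
rewrite (_ : \sum_(x | _) _ = \sum_w \sum_(a | P (upd w a)) 1); last first.
  by rewrite pair_big_dep.
apply: (@le_trans _ _ (\sum_(w : {ffun I -> A}) q * #|A|%:R)).
  apply: ler_sum => w _; apply: le_trans (h w).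
  rewrite -sum1_card natr_sum le_eqVlt; apply/orP; left; apply/eqP.
  by apply: eq_bigl => a; rewrite inE.
by rewrite sumr_const -[X in X <= _]mulr_natr mulrAC.
Qed.

(** * Deterministic error invariant *)

Lemma freq_rcons (R : realType) (m : nat) (s : seq ('I_m * R)) (i x : 'I_m) (d : R) :
  freq (rcons s (i, d)) x = freq s x + (if x == i then d else 0).
Proof. by rewrite /freq big_rcons /= eq_sym. Qed.

Section Invariant.
Variables (R : realType) (c : R) (m k l : nat).

(* E stands for the sum of all the medians subtracted so far. *)
Definition err_inv (s : seq ('I_m * R)) (st : state R m) (E : R) : Prop :=
  [/\ (#|st.1| <= k)%N,
      forall x, x \in st.1 -> 0 <= st.2 x,
      forall x, 0 <= freq s x - estimate st x <= E
    & k%:R / c * E <= \sum_x (freq s x - estimate st x)].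

(** Covers the updates without DecrementCounters, which raise frequency and estimate by the same
    amount. *)
Lemma err_inv_eq_err (s s' : seq ('I_m * R)) (st st' : state R m) (E : R) :
  (#|st'.1| <= k)%N -> (forall x, x \in st'.1 -> 0 <= st'.2 x) ->
  (forall x, freq s' x - estimate st' x = freq s x - estimate st x) ->
  err_inv s st E -> err_inv s' st' E.
Proof.
move=> Tk c0 eq_err [_ _ bd sm]; split => // [x|]; first by rewrite eq_err.
by under eq_bigr do rewrite eq_err.
Qed.

Lemma sample_median_counter (st : state R m) (r : rnd k l) :
  (0 < l)%N -> #|st.1| = k ->
  exists2 x, x \in st.1 & sample_median st r = st.2 x.
Proof.
move=> l0 Tk; pose vals := [seq st.2 x | x <- enum st.1].
have [a E] := sample_median_mem (fun a : 'I_k => nth 0 vals a) r l0.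
have : nth 0 vals a \in vals by rewrite mem_nth // size_map -cardE Tk.
by case/mapP => x; rewrite mem_enum => xT Ex; exists x; rewrite // -Ex -E.
Qed.

Lemma err_inv_update (s : seq ('I_m * R)) (st : state R m) (u : 'I_m * R)
    (r : rnd k l) (E : R) :
  (0 < l)%N -> 0 < u.2 -> err_inv s st E -> ~~ bad_median c st r ->
  exists E', err_inv (rcons s u) (update st u r) E'.
Proof.
case: u => i d l0 /= d0 inv; have [Tk c0 bd sm] := inv => good.
have [iT|iT] := boolP (i \in st.1).
  exists E; apply: err_inv_eq_err inv => //= x.
    by rewrite /setc; case: eqP => [->|_] /c0 // h; rewrite addr_ge0 // ltW.
  rewrite freq_rcons /estimate /setc /=.
  by case: eqP => [->|_]; rewrite ?iT; [ring | rewrite addr0].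
have [lt_k|ge_k] := ltnP #|st.1| k.
  exists E; apply: err_inv_eq_err inv => //= [|x|x].
  - by rewrite cardsU1 iT.
  - by rewrite !inE /setc; case: eqP => [_ _|_ /c0 //]; exact: ltW.
  rewrite freq_rcons /estimate /setc /= !inE.
  by case: eqP => [->|_] /=; rewrite ?(negbTE iT); [ring | rewrite addr0].
have {}Tk : #|st.1| = k by apply/eqP; rewrite eqn_leq Tk.
set cs := sample_median st r.
have [y yT csE] : exists2 x, x \in st.1 & cs = st.2 x.
  exact: sample_median_counter.
have cs0 : 0 <= cs by rewrite csE c0.
set T' := [set x in st.1 | 0 < st.2 x - cs].
have iT' : i \notin T' by rewrite inE (negbTE iT).
(* The counter equal to the median drops to zero and leaves [T], which makes room for [i]. *)
have T'k : (#|T'| < k)%N.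
  rewrite -Tk; apply: proper_card; apply/properP; split.
    by apply/subsetP => x; rewrite inE => /andP[].
  by exists y => //; rewrite inE yT csE subrr ltxx.
set st' := if _ then _ else _.
(* Subtracting the median cuts every count at zero, so that the error of x
   grows by the smaller of the median and the count of x. *)
pose g x : R := estimate st x + (if x == i then d else 0).
have est0 x : 0 <= estimate st x by rewrite /estimate; case: ifP => // /c0.
have estE x : estimate st' x = Num.max 0 (g x - cs).
  rewrite /g /st' /estimate /setc; have [->|xi] := eqVneq x i.
    rewrite (negbTE iT) add0r; case: (leP cs d) => h /=.
      by rewrite setU11 eqxx; apply/esym/max_idPr; rewrite subr_ge0.
    by rewrite (negbTE iT'); apply/esym/max_idPl; rewrite subr_le0 ltW.
  rewrite addr0; case: (leP cs d) => h /=; rewrite !inE ?(negbTE xi) /=;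
    (case: (boolP (x \in st.1)) => xT /=;
      last by apply/esym/max_idPl; rewrite sub0r oppr_le0);
    by case: ltP.
have g0 x : 0 <= g x by rewrite addr_ge0 //; case: ifP => // _; exact: ltW.
have errE x : freq (rcons s (i, d)) x - estimate st' x =
    freq s x - estimate st x + Num.min (g x) cs.
  rewrite freq_rcons estE.
  have -> : Num.min (g x) cs = g x - Num.max 0 (g x - cs).
    by rewrite maxEle minEle subr_ge0; case: leP => h; case: leP => h'; lra.
  by rewrite /g; ring.
exists (E + cs); split => [|x|x|].
- rewrite /st'; case: ifP => _ /=; last exact: ltnW.
  by rewrite cardsU1 iT' add1n.
- rewrite /st' /setc; case: leP => h /=; rewrite !inE.
    case: eqP => [_ _|_ /= /andP[_ /ltW //]].
    by rewrite subr_ge0.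
  by case/andP => _ /ltW.
- rewrite errE; have /andP[b1 b2] := bd x.
  rewrite addr_ge0 //=; last by rewrite le_min g0.
  by rewrite lerD // ge_min lexx orbT.
under eq_bigr do rewrite errE.
rewrite big_split mulrDr lerD //=.
move: good; rewrite /bad_median Tk eqxx /= -leNgt -/cs => good.
(* At least [k / c] counters reach a good median, and the error of each grows by exactly [cs]. *)
apply: (@le_trans _ _ (\sum_(x in [set x in st.1 | cs <= st.2 x]) cs)).
  by rewrite sumr_const -[leRHS]mulr_natl ler_wpM2r.
rewrite [leRHS](bigID (mem [set x in st.1 | cs <= st.2 x])) /=.
rewrite ler_wpDr ?sumr_ge0 //; first by move=> x _; rewrite le_min g0.
apply: ler_sum => x; rewrite inE => /andP[xT csx].
rewrite le_min lexx andbT; apply: (le_trans csx).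
by rewrite /g /estimate xT ler_wpDr //; case: ifP => // _; exact: ltW.
Qed.

(** The default [r0] is quantified because [rnd k l] is empty when [k = 0]. *)
Lemma err_inv_run (s : seq ('I_m * R)) (rs : seq (rnd k l)) :
  (0 < l)%N -> size s = size rs -> all (fun p => 0 < p.2) s ->
  (forall t r0, (t < size rs)%N ->
     ~~ bad_median c (run (take t s) (take t rs)) (nth r0 rs t)) ->
  exists E, err_inv s (run s rs) E.
Proof.
move=> l0; elim/last_ind: s rs => [|s u IH] rs.
  case: rs => // _ _ _; exists 0; split => //=.
  - by rewrite cards0.
  - by move=> x; rewrite /freq big_nil /estimate inE subr0 lexx.
  rewrite mulr0 sumr_ge0 // => x _.
  by rewrite /freq big_nil /estimate inE subr0.
case/lastP: rs => [|rs r]; first by rewrite size_rcons.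
rewrite !size_rcons => -[sz]; rewrite all_rcons => /andP[u0 s0] good.
have [t r0 lt_t|E inv] := IH rs sz s0.
  have := good t r0 (ltnW lt_t).
  rewrite nth_rcons lt_t -!cats1 !takel_cat ?sz //; exact: ltnW.
have := good (size rs) r (ltnSn _).
rewrite nth_rcons ltnn eqxx -{1}sz -!cats1 !take_size_cat // !cats1 => gd.
by rewrite /run zip_rcons // foldl_rcons; exact: (err_inv_update l0 u0 inv gd).
Qed.

(* The j heaviest items contribute at most j * E to the total error, and every
   other item at most its own frequency. *)
Lemma err_inv_Nres (s : seq ('I_m * R)) (st : state R m) (E : R) (j : nat) (i : 'I_m) :
  err_inv s st E -> j%:R < k%:R / c ->
  freq s i - estimate st i <= Nres s j / (k%:R / c - j%:R).
Proof.
move=> [_ c0 bd sm] hj.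
have E0 : 0 <= E by have /andP[h1 h2] := bd i; exact: le_trans h2.
have /andP[_ /le_trans->] // := bd i.
rewrite ler_pdivlMr ?subr_gt0 // mulrC mulrBl lerBlDl; apply: (le_trans sm).
(* Sorting the items rather than their frequencies lets the errors be summed in the same order. *)
rewrite /Nres sort_map -map_drop big_map.
set es := sort _ _.
have -> : \sum_x (freq s x - estimate st x) = \sum_(x <- es) (freq s x - estimate st x).
  by rewrite -big_enum; apply: perm_big; rewrite perm_sym perm_sort.
rewrite -{1}(cat_take_drop j es) big_cat lerD //=; last first.
  by apply: ler_sum => x _; rewrite gerBl /estimate; case: ifP => // /c0.
apply: (@le_trans _ _ (\sum_(x <- take j es) E)).
  by apply: ler_sum => x _; have /andP[] := bd x.
rewrite big_const_seq count_predT iter_addr_0 -[leLHS]mulr_natl ler_wpM2r // ler_nat.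
by rewrite size_take_min geq_minl.
Qed.

End Invariant.

(** The bound on [ell] starts at [n = 2] since [trunc_log 2 1 = 0]. Taking [j] in ['I_k] covers
    every [j < k / c], as [c > 1]. Each update owns one sample, and counting over [w] makes these
    samples independent and uniform. *)
Theorem theorem8 (R : realType) (c : R) :
  2 < c ->
  exists ell : nat -> nat,
    (exists C : nat, forall n : nat, (2 <= n)%N -> (ell n <= C * trunc_log 2 n)%N) /\
    forall n : nat, (0 < n)%N ->
      (0 < ell n)%N /\
      forall (m k : nat) (s : seq ('I_m * R)),
        (0 < k)%N -> size s = n -> all (fun p => 0 < p.2) s ->
        1 - n%:R^-1 <=
        prob R (fun w : {ffun 'I_n -> rnd k (ell n)} =>
          let st := run s [seq w t | t <- enum 'I_n] in
          [forall i : 'I_m, forall j : 'I_k,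
             (j%:R < k%:R / c) ==>
             ((0 <= freq s i - estimate st i) &&
              (freq s i - estimate st i <= Nres s j / (k%:R / c - j%:R)))]).
Proof.
move=> c2; have [K [K0 hK]] := tail_rate_exp_small c2.
(* Each block of [K] draws gains a factor 4, and [n < 2 ^ (trunc_log 2 n).+1], so the tail is at
   most [n ^ -2]. *)
exists (fun n => (K * (trunc_log 2 n).+1)%N); split.
  exists (2 * K)%N => n n2.
  have : (0 < trunc_log 2 n)%N by rewrite trunc_log_gt0.
  by nia.
move=> n n0; set l := (K * _)%N.
have l0 : (0 < l)%N by rewrite muln_gt0 K0.
split => // m k s k0 sz s0.
pose rs (w : {ffun 'I_n -> rnd k l}) := [seq w t | t <- enum 'I_n].
pose bad (t : 'I_n) w := bad_median c (run (take t s) (take t (rs w))) (w t).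
set good := (X in prob R X).
have rate_le : tail_rate c ^+ l <= (n%:R ^+ 2)^-1.
  rewrite /l exprM; apply: (@le_trans _ _ (4^-1 ^+ (trunc_log 2 n).+1)).
    by apply: lerXn2r; rewrite ?nnegrE ?exprn_ge0 ?(tail_rate_ge0 c2) ?invr_ge0.
  rewrite exprVn lef_pV2 ?posrE ?exprn_gt0 ?ltr0n //.
  rewrite -!natrX ler_nat (_ : 4 = 2 ^ 2)%N // -expnM mulnC expnM.
  by rewrite leq_exp2r // ltnW // trunc_log_ltn.
have bad_le t : #|bad t|%:R <= (n%:R ^+ 2)^-1 * #|{ffun 'I_n -> rnd k l}|%:R :> R.
  (* The state before update [t] depends on earlier samples only, so redrawing coordinate [t] leaves
     it unchanged. *)
  apply: (@card_resample_le R _ _ t).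
    by rewrite card_ffun !card_ord expn_gt0 k0.
  move=> w; apply: (@le_trans _ _ (tail_rate c ^+ l * #|{: rnd k l}|%:R)); last first.
    by rewrite ler_wpM2r.
  apply: le_trans (card_bad_median_le c2 (run (take t s) (take t (rs w))) k0 l0).
  rewrite ler_nat; apply/subset_leq_card/subsetP => a; rewrite !inE /bad.
  rewrite ffunE eqxx; congr (bad_median c (run _ _) a).
  rewrite /rs -[LHS]map_take -[RHS]map_take; apply/eq_in_map => u ut; rewrite ffunE.
  by case: eqP ut => // ->; rewrite in_take ?mem_enum // index_enum_ord ltnn.
have good_or_bad w : good w || [exists t, bad t w].
  rewrite orbC; case: existsP => //= nbad.
  have szr : size (rs w) = n by rewrite size_map size_enum_ord.
  have [||t r0|E inv] := @err_inv_run R c m k l s (rs w) l0; rewrite ?szr //.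
    move=> lt_t; apply/negP => bt; apply: nbad; exists (Ordinal lt_t).
    move: bt; rewrite (nth_map (Ordinal lt_t)) ?size_enum_ord //.
    by rewrite (nth_ord_enum _ (Ordinal lt_t)).
  apply/forallP => i; apply/forallP => j; apply/implyP => hj.
  rewrite (err_inv_Nres i inv hj) andbT.
  by case: inv => _ _ /(_ i) /andP[].
have Om0 : 0 < #|{ffun 'I_n -> rnd k l}|%:R :> R.
  by rewrite ltr0n !card_ffun !card_ord !expn_gt0 k0.
rewrite /prob ler_pdivlMr // mulrBl mul1r lerBlDr.
(* Union bound in counting form: [n] bad events, each of proportion at most [n ^ -2], cost at most
   [1 / n]. *)
have card_le : (#|{ffun 'I_n -> rnd k l}| <= #|good| + \sum_t #|bad t|)%N.
  rewrite -sum1_card -[X in (_ <= X + _)%N]sum1_card.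
  under [X in (_ <= _ + X)%N]eq_bigr do rewrite -sum1_card big_mkcond.
  rewrite exchange_big [X in (_ <= X + _)%N]big_mkcond -big_split /=.
  apply: leq_sum => w _; have /orP[gw|/existsP[t bt]] := good_or_bad w.
    by have -> : w \in good by [].
  have bt' : w \in bad t by [].
  by rewrite (bigD1 t) //= bt' addnCA leq_addr.
apply: (@le_trans _ _ (#|good| + \sum_t #|bad t|)%:R).
  by rewrite ler_nat.
rewrite natrD lerD2l natr_sum.
apply: (le_trans (ler_sum _ (fun t _ => bad_le t))).
rewrite sumr_const card_ord -[X in X <= _]mulr_natl mulrA.
have nn0 : n%:R != 0 :> R by rewrite pnatr_eq0 -lt0n.
by rewrite expr2 invfM mulrA divff // mul1r.
Qed.
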